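(* Let $O_1,\dots,O_n$ be i.i.d. copies of $O=(W,A,Y)\sim P_0\in\mathcal{M}$, with $W\in\mathbb{R}^p$, $A\in\{0,1\}$, $Y\in\{0,1\}$, where $\mathcal{M}$ is the nonparametric model (with positivity). For $P\in\mathcal{M}$ let $$\Sigma^2(P)=E_P\left[\frac{1}{\psi_1(P)^2}\frac{\bar Q_P(1,W)(1-\bar Q_P(1,W))}{g_P(1\mid W)}+\frac{1}{\psi_0(P)^2}\frac{\bar Q_P(0,W)(1-\bar Q_P(0,W))}{g_P(0\mid W)}+\left(\frac{\bar Q_P(1,W)}{\psi_1(P)}-\frac{\bar Q_P(0,W)}{\psi_0(P)}\right)^2\right],$$ write $\Sigma_0^2=\Sigma^2(P_0)$, and let $D^*_{\Sigma^2,P}$ be the efficient influence function of $\Sigma^2$ at $P$. Let $P_n^{**}$ be the targeted (TMLE-updated) estimate of $P_0$, which solves the efficient influence function estimating equation $P_nD^*_{\Sigma^2,P_n^{**}}=o_P(n^{-1/2})$, and let $\Sigma_n^{2,TMLE}=\Sigma^2(P_n^{**})$. Define the second-order remainder $$R_2(P_n^{**},P_0)=\Sigma^2(P_n^{**})-\Sigma_0^2+P_0D^*_{\Sigma^2,P_n^{**}}.$$ Suppose that: 1. (Donsker class condition) $D^*_{\Sigma^2,P_n^{**}}$ belongs to a $P_0$-Donsker class with probability tending to 1; 2. (Second-order remainder) $R_2(P_n^{**},P_0)=o_P(n^{-1/2})$; 3. (Consistency) $P_0\{D^*_{\Sigma^2,P_n^{**}}-D^*_{\Sigma^2,P_0}\}^2\to_p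 0$. Then $\Sigma_n^{2,TMLE}$ is an asymptotically efficient estimator of $\Sigma_0^2$: $$\Sigma_n^{2,TMLE}-\Sigma_0^2=\frac1n\sum_{i=1}^nD^*_{\Sigma^2,P_0}(O_i)+o_P(n^{-1/2}).$$
   Context: Notation: $\bar Q_P(a,w)=E_P(Y\mid A=a,W=w)$, $g_P(a\mid w)=P(A=a\mid W=w)$, $\psi_a(P)=E_P[\bar Q_P(a,W)]$ for $a\in\{0,1\}$. For a (possibly data-dependent) function $f$ of $O$, $P_0f=\int f\,dP_0$ (the function held fixed), and $P_nf=\frac1n\sum_{i=1}^nf(O_i)$ with $P_n$ the empirical distribution. Positivity means $0<g_P(1\mid W)<1$ almost surely, and $\psi_0(P),\psi_1(P)>0$. The model is nonparametric: the tangent space at $P$ is the whole space of mean-zero, finite-variance functions under $P$. The efficient influence function $D^*_{\Sigma^2,P}$ is the canonical gradient of $\Sigma^2$ at $P$: the mean-zero square-integrable function in the tangent space whose $L^2(P)$ inner product with the score of any regular one-dimensional submodel through $P$ equals the derivative of $\Sigma^2$ along that submodel. An estimator is asymptotically efficient if it is asymptotically linear with influence function equal to the efficient influence function. The targeted distribution $P_n^{**}$ is determined by updated estimates $\bar Q_n^{**}$ of $\bar Q_{P_0}$ and $g_n^{**}$ of $g_{P_0}$, together with the empirical distribution of $W$ as its marginal distribution of $W$; $\Sigma_n^{2,TMLE}$ is the plug-in estimator, i.e. $\Sigma^2$ evaluated at these estimates. By construction, the targeting step of the TMLE produces updates with $P_nD^*_{\Sigma^2,P_n^{**}}=o_P(n^{-1/2})$.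 *)

(* Defs.v *)
From HB Require Import structures.
From mathcomp Require Import all_boot all_order all_algebra finmap.
From mathcomp Require Import all_classical all_reals all_analysis.

Set Implicit Arguments.
Unset Strict Implicit.
Unset Printing Implicit Defensive.

Import Order.TTheory GRing.Theory Num.Theory.
Import numFieldNormedType.Exports.

Local Open Scope classical_set_scope.
Local Open Scope ring_scope.

(* No measurability in the sample point is assumed for the data-dependent
   quantities, so probabilities and expectations of them are outer ones, as
   usual in empirical process theory; on measurable sets and integrable
   functions they are the ordinary ones. *)

Section stochastic_order.
Context d (Om : measurableType d) (R : realType) (Pr : probability Om R).

Definition outer_probability (A : set Om) : \bar R := mu_ext Pr A.

Definition cvg0_in_probability (Z : nat -> Om -> \bar R) : Prop :=
  forall e : R, 0 < e ->
    outer_probability [set w | (e%:E < `|Z n w|)%E] @[n --> \oo] --> 0%E.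

Definition small_oP (r : nat -> R) (Z : nat -> Om -> R) : Prop :=
  cvg0_in_probability (fun n w => (Z n w / r n)%:E).

Definition root_n_rate (n : nat) : R := (Num.sqrt n%:R)^-1.

Definition outer_expectation (Z : Om -> R) : \bar R :=
  ereal_inf [set (\int[Pr]_w U w)%E | U in
    [set U : Om -> \bar R |
      Pr.-integrable setT U /\ forall w, ((Z w)%:E <= U w)%E]].

End stochastic_order.

Section empirical_process.
Context (R : realType) dT (T : measurableType dT) (P : probability T R).

Definition mean (f : T -> R) : R := \int[P]_x f x.

Definition variance_of (f : T -> R) : R := mean (fun x => (f x - mean f) ^+ 2).

Section sample.
Context d (Om : measurableType d) (Pr : probability Om R).
Variable X : nat -> {RV Pr >-> T}.

Definition iid_sample : Prop :=
  (forall i (B : set T), measurable B -> distribution Pr (X i) B = P B) /\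
  (forall (J : {fset nat}) (B : nat -> set T), (forall i, measurable (B i)) ->
    Pr (\bigcap_(i in [set` J]) X i @^-1` B i) =
    (\prod_(i <- J) Pr (X i @^-1` B i))%E).

(* The observations O_1, ..., O_n are X 0, ..., X n.-1. *)
Definition emp_mean (n : nat) (w : Om) (f : T -> R) : R :=
  n%:R^-1 * \sum_(i < n) f (X i w).

Definition emp_process (n : nat) (w : Om) (f : T -> R) : R :=
  Num.sqrt n%:R * (emp_mean n w f - mean f).

Definition asymptotically_linear (est : nat -> Om -> R) (theta : R)
    (IF : T -> R) : Prop :=
  small_oP Pr (root_n_rate R) (fun n w => est n w - theta - emp_mean n w IF).

End sample.

(* The space l^oo(F) is represented by the functions on all of [T -> R] that
   are bounded on [F], with the topology of uniform convergence on [F]: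
   functions that agree on [F] are topologically indistinguishable, so values
   outside [F] are irrelevant to continuity, openness and compactness. *)
Definition linfty (F : set (T -> R)) : set {uniform` F -> R} :=
  [set z | exists M : R, forall f, F f -> `|z f| <= M].
Arguments linfty F _ : clear implicits.

Definition linfty_borel (F : set (T -> R)) :=
  g_sigma_algebraType (@open {uniform` F -> R}).

(* N(0, v), including the degenerate case v = 0, for which the library's
   [normal_prob] is not the Dirac mass *)
Definition centered_gaussian (v : R) (A : set R) : \bar R :=
  if v == 0 then \d_(0 : R) A else normal_prob 0 (Num.sqrt v) A.

(* Every linear combination of coordinates f_1, ..., f_k in F is
   N(0, Var_P (c_1 f_1 + ... + c_k f_k)): the coordinate process is centered
   Gaussian with covariance P(fg) - (Pf)(Pg). *)
Definition brownian_bridge_law (F : set (T -> R))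
    (L : probability (linfty_borel F) R) : Prop :=
  forall (k : nat) (f : 'I_k -> T -> R) (c : 'I_k -> R) (A : set R),
    (forall i, F (f i)) -> measurable A ->
    L [set z : {uniform` F -> R} | A (\sum_(i < k) c i * z (f i))] =
    centered_gaussian (variance_of (fun x => \sum_(i < k) c i * f i x)) A.

Definition tight_law (F : set (T -> R)) (L : probability (linfty_borel F) R) :
    Prop :=
  forall e : R, 0 < e -> exists K : set {uniform` F -> R},
    [/\ K `<=` linfty F, closed K, compact K & (1 - e%:E <= L K)%E].

(* Weak convergence (Hoffmann-Jorgensen) in l^oo(F) of the empirical process of
   any i.i.d. sample from P to a tight P-Brownian bridge. *)
Definition donsker (F : set (T -> R)) : Prop :=
  [/\ forall f, F f -> f \in Lfun P 2%:E,
      forall x, exists M : R, forall f, F f -> `|f x - mean f| <= M &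
      exists L : probability (linfty_borel F) R,
        [/\ L (linfty F) = 1%E, tight_law L, brownian_bridge_law L &
          forall d (Om : measurableType d) (Pr : probability Om R)
            (X : nat -> {RV Pr >-> T}), iid_sample X ->
          forall h : {uniform` F -> R} -> R,
            {within linfty F, continuous h} ->
            (exists M : R, forall z, linfty F z -> `|h z| <= M) ->
            outer_expectation Pr (fun w => h (emp_process X n w))
              @[n --> \oo] --> (\int[L]_(z in linfty F) (h z)%:E)%E]].

End empirical_process.

Section observed_data.
Context (R : realType) (p : nat).

(* O = (W, A, Y); A and Y in {0, 1} are booleans. *)
Definition obs : Type := (p.-tuple R * bool * bool)%type.

HB.instance Definition _ := Measurable.on obs.

Definition obsW (o : obs) : p.-tuple R := o.1.1.
Definition obsA (o : obs) : bool := o.1.2.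
Definition obsY (o : obs) : bool := o.2.

Lemma measurable_obsW : measurable_fun setT obsW.
Proof. exact: measurableT_comp measurable_fst measurable_fst. Qed.

Lemma measurable_obsA : measurable_fun setT obsA.
Proof. exact: measurableT_comp measurable_snd measurable_fst. Qed.

Lemma measurable_obsY : measurable_fun setT obsY.
Proof. exact: measurable_snd. Qed.

HB.instance Definition _ := isMeasurableFun.Build _ _ _ _ obsW measurable_obsW.

Lemma measurable_A_eq (a : bool) : measurable (obsA @^-1` [set a]).
Proof. by rewrite -[X in measurable X]setTI; exact: measurable_obsA. Qed.

Lemma measurable_Y_eq (y : bool) : measurable (obsY @^-1` [set y]).
Proof. by rewrite -[X in measurable X]setTI; exact: measurable_obsY. Qed.

Lemma measurable_AY_eq (a y : bool) :
  measurable (obsA @^-1` [set a] `&` obsY @^-1` [set y]).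
Proof. by apply: measurableI; [exact: measurable_A_eq|exact: measurable_Y_eq]. Qed.

(* the measure P(W \in -, O \in D) *)
Section W_restricted.
Variables (P : probability obs R) (D : set obs) (mD : measurable D).

Definition lawW_on : set (p.-tuple R) -> \bar R :=
  pushforward (mrestr P mD) obsW.

Let lawW_on0 : lawW_on set0 = 0%E.
Proof. by rewrite /lawW_on /pushforward preimage_set0 measure0. Qed.

Let lawW_on_ge0 B : (0 <= lawW_on B)%E.
Proof. exact: measure_ge0. Qed.

Let lawW_on_sigma_additive : semi_sigma_additive lawW_on.
Proof.
move=> F mF tF mUF; rewrite /lawW_on /pushforward preimage_bigcup.
apply: measure_semi_sigma_additive.
- by move=> n; rewrite -[X in measurable X]setTI; exact: measurable_obsW.
- apply/trivIsetP => /= i j _ _ ij; rewrite -preimage_setI.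
  by move/trivIsetP : tF => /(_ _ _ _ _ ij) ->//; rewrite preimage_set0.
- by rewrite -preimage_bigcup -[X in measurable X]setTI; exact: measurable_obsW.
Qed.

HB.instance Definition _ := isMeasure.Build _ _ _ lawW_on
  lawW_on0 lawW_on_ge0 lawW_on_sigma_additive.

Let lawW_on_fin : fin_num_fun lawW_on.
Proof.
move=> B mB; apply: fin_num_measure.
by rewrite -[X in measurable X]setTI; exact: measurable_obsW.
Qed.

HB.instance Definition _ := @Measure_isFinite.Build _ _ _ lawW_on lawW_on_fin.

End W_restricted.

Section parameter.
Variable P : probability obs R.

(* g_P(a | w) = P(A = a | W = w) *)
Definition gP (a : bool) (w : p.-tuple R) : R :=
  fine (Radon_Nikodym (charge_of_finite_measure (lawW_on P (measurable_A_eq a)))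
                      (distribution P obsW) w).

(* E_P(Y | A = a, W = w) = P(Y = 1 | A = a, W = w), as Y is binary *)
Definition QbarP (a : bool) (w : p.-tuple R) : R :=
  fine (Radon_Nikodym
          (charge_of_finite_measure (lawW_on P (measurable_AY_eq a true)))
          (lawW_on P (measurable_A_eq a)) w).

Definition psi (a : bool) : R := mean P (fun o => QbarP a (obsW o)).

Definition in_model : Prop :=
  {ae P, forall o, 0 < gP true (obsW o) < 1} /\
  (0 < psi true /\ 0 < psi false).

Definition Sigma2_integrand (w : p.-tuple R) : R :=
  (psi true ^+ 2)^-1 * (QbarP true w * (1 - QbarP true w) / gP true w) +
  (psi false ^+ 2)^-1 * (QbarP false w * (1 - QbarP false w) / gP false w) +
  (QbarP true w / psi true - QbarP false w / psi false) ^+ 2.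

(* possibly +oo if g_P is not bounded away from 0 and 1 *)
Definition Sigma2 : \bar R := (\int[P]_o (Sigma2_integrand (obsW o))%:E)%E.

End parameter.

(* A one-dimensional submodel through P (at t = 0) with densities p_t with
   respect to P, differentiable in quadratic mean with score s.  The likelihood
   ratios are uniformly bounded away from 0 and oo near t = 0: an unbounded
   perturbation of g_P destroys differentiability of 1/g_P-weighted means such
   as Sigma2.  If P is in the model, every
   s in L^2_0(P) is the score of such a submodel. *)
Definition regular_submodel (P : probability obs R)
    (Pt : R -> probability obs R) (s : obs -> R) : Prop :=
  [/\ forall B, measurable B -> Pt 0 B = P B,
      \forall t \near (0 : R), in_model (Pt t),
      s \in Lfun P 2%:E &
      exists dens : R -> obs -> R, exists C : R,
        [/\ 0 < C,
            \forall t \near (0 : R), [/\ measurable_fun setT (dens t),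
              forall o, C^-1 <= dens t o <= C &
              forall B, measurable B ->
                Pt t B = (\int[P]_(o in B) (dens t o)%:E)%E] &
            (\int[P]_o (((Num.sqrt (dens t o) - 1) / t - s o / 2) ^+ 2)%:E)%E
              @[t --> 0^'] --> 0%E]].

(* The model being nonparametric, the tangent space is the whole L^2_0(P). *)
Definition tangent_space (P : probability obs R) : set (obs -> R) :=
  [set s | s \in Lfun P 2%:E /\ mean P s = 0].

(* [D] is (a version of) the canonical gradient at [P] of a parameter [Psi]
   that is finite at [P]. *)
Definition efficient_influence_function (Psi : probability obs R -> \bar R)
    (P : probability obs R) (D : obs -> R) : Prop :=
  [/\ Psi P \is a fin_num,
      tangent_space P D &
      forall Pt s, regular_submodel P Pt s ->
        is_derive (0 : R) (1 : R) (fun t : R => fine (Psi (Pt t)))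
          (mean P (fun o => D o * s o))].

Definition asymptotically_efficient d (Om : measurableType d)
    (Pr : probability Om R) (X : nat -> {RV Pr >-> obs})
    (Psi : probability obs R -> \bar R) (P0 : probability obs R)
    (est : nat -> Om -> R) (D : obs -> R) : Prop :=
  efficient_influence_function Psi P0 D /\
  asymptotically_linear X est (fine (Psi P0)) D.

Definition bernoulli_mass (q : R) (b : bool) : R := if b then q else 1 - q.

(* Law of (W, A, Y) with W drawn from the empirical distribution of
   W_1, ..., W_n, A | W ~ Bernoulli(g(W)), Y | A, W ~ Bernoulli(Q(A, W)). *)
Definition targeted_distribution d (Om : measurableType d)
    (Pr : probability Om R) (X : nat -> {RV Pr >-> obs}) (n : nat) (w : Om)
    (Q : bool -> p.-tuple R -> R) (g : p.-tuple R -> R)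
    (P : probability obs R) : Prop :=
  forall (B : set (p.-tuple R)) (a y : bool), measurable B ->
    P [set o | [/\ B (obsW o), obsA o = a & obsY o = y]] =
    (emp_mean X n w (fun o => \1_B (obsW o) * bernoulli_mass (g (obsW o)) a *
       bernoulli_mass (Q a (obsW o)) y))%:E.

Definition second_order_remainder (Psi : probability obs R -> \bar R)
    (P P0 : probability obs R) (DP : obs -> R) : R :=
  fine (Psi P) - fine (Psi P0) + mean P0 DP.

End observed_data.

(* Main.v *)
(* With G_n = sqrt n (P_n - P_0) and P_0 D_0 = 0,
     Sigma^2(P_n-star) - Sigma_0^2 - P_n D_0 =
       R_2 - P_n D_n-star + n^(-1/2) (G_n D_n-star - G_n D_0),
   so it is enough that G_n D_n-star - G_n D_0 tends to 0 in probability.  This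
   is the asymptotic equicontinuity of the empirical process over a Donsker
   class F, here at the centre D_0, which need not belong to F: if f_n in F is
   L^2-close to D_0, compare G_n f_n with G_n h for a fixed h in F close to D_0.
   The difference G_n h - G_n D_0 is small by Chebyshev's inequality, and the
   supremum of min (c, |z f - z h|) over the f in F close to D_0 is a bounded
   continuous function of z, whose expectation tends to its integral under the
   Brownian bridge.  That integral is small by tightness and because the bridge
   has small Gaussian increments between L^2-close functions. *)
Require Import Defs.
From HB Require Import structures.
From mathcomp Require Import all_boot all_order all_algebra finmap.
From mathcomp Require Import all_classical all_reals all_analysis.
From mathcomp Require Import measurable_realfun.
From mathcomp Require Import ring lra.

Set Implicit Arguments.
Unset Strict Implicit.
Unset Printing Implicit Defensive.

Import Order.TTheory GRing.Theory Num.Theory.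
Import numFieldNormedType.Exports.

Local Open Scope classical_set_scope.
Local Open Scope ring_scope.

(** * Tail bounds for centered Gaussian laws *)

Section gaussian_tail.
Variable R : realType.

(* The wider normal density, of standard deviation [2 s], absorbs the tail, so
   that no second moment of the normal law is needed. *)
Lemma normal_pdf_tail (s e x : R) : 0 < s -> 0 < e -> e < `|x| ->
  normal_pdf 0 s x <= 6 * s ^+ 2 / e ^+ 2 * normal_pdf 0 (2 * s) x.
Proof.
move=> s0 e0 ex.
rewrite !normal_pdfE ?gt_eqF ?mulr_gt0// /normal_peak /normal_fun !subr0.
have -> : (2 * s) ^+ 2 * pi *+ 2 = 2 ^+ 2 * (s ^+ 2 * pi *+ 2) by ring.
rewrite sqrtrM ?sqr_ge0// sqrtr_sqr ger0_norm// [(2 * _)^-1]invfM.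
set q := (Num.sqrt _)^-1.
have q0 : 0 <= q by rewrite invr_ge0.
have -> : expR (- x ^+ 2 / (s ^+ 2 *+ 2)) =
    expR (- x ^+ 2 / ((2 * s) ^+ 2 *+ 2)) * expR (- (3 / 8 * x ^+ 2 / s ^+ 2)).
  by rewrite -expRD; congr expR; field; rewrite gt_eqF.
set E := expR (- x ^+ 2 / ((2 * s) ^+ 2 *+ 2)).
have E0 : 0 <= E by exact: expR_ge0.
(* The two peaks differ by a factor 2, which turns this 3 into the constant 6. The bound itself is
   [u <= expR u] at [u = 3/8 x^2/s^2], where 3/8 is lowered to 1/3. *)
suff h : expR (- (3 / 8 * x ^+ 2 / s ^+ 2)) <= 3 * s ^+ 2 / e ^+ 2.
  rewrite [leRHS](_ : _ = q * E * (3 * s ^+ 2 / e ^+ 2));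
    last by field; rewrite gt_eqF.
  by rewrite mulrA ler_wpM2l// mulr_ge0.
have ex2 : e ^+ 2 <= x ^+ 2.
  by rewrite -[x ^+ 2]real_normK ?num_real// ler_pXn2r// ?nnegrE ltW.
have u0 : 0 < e ^+ 2 / (3 * s ^+ 2) by rewrite divr_gt0 ?mulr_gt0 ?exprn_gt0.
have -> : 3 * s ^+ 2 / e ^+ 2 = (e ^+ 2 / (3 * s ^+ 2))^-1 by rewrite invf_div.
rewrite expRN lef_pV2 ?posrE ?expR_gt0//.
apply: le_trans (expR_ge1Dx _).
rewrite -[leLHS]add0r lerD//.
have -> : e ^+ 2 / (3 * s ^+ 2) = (1 / 3) * e ^+ 2 / s ^+ 2 by field; rewrite gt_eqF.
rewrite ler_wpM2r ?invr_ge0 ?sqr_ge0//.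
have := sqr_ge0 x; lra.
Qed.

Lemma measurable_norm_gt (e : R) : measurable [set x : R | e < `|x|].
Proof.
have -> : [set x : R | e < `|x|] = (@Num.norm _ R) @^-1` [set` `]e, +oo[].
  by apply/seteqP; split => x /=; rewrite in_itv/= andbT.
rewrite -[X in measurable X]setTI; exact: normr_measurable.
Qed.

(** Integrating the comparison of densities leaves the constant times the mass of a set under the
    wider normal law, which is at most 1. In the degenerate case the Dirac mass at 0 does not charge
    the tail. *)
Lemma centered_gaussian_tail (v e : R) : 0 <= v -> 0 < e ->
  (centered_gaussian v [set x : R | (e < `|x|)%R] <= (6 * v / e ^+ 2)%:E)%E.
Proof.
move=> v0 e0; rewrite /centered_gaussian; case: eqVneq => [->|vN0].
  rewrite diracE memNset ?mulr0 ?mul0r//= normr0 => h.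
  by have := lt_trans h e0; rewrite ltxx.
have s0 : 0 < Num.sqrt v by rewrite sqrtr_gt0 lt_neqAle eq_sym vN0.
rewrite /normal_prob.
apply: (@le_trans _ _ (\int[lebesgue_measure]_(x in [set x : R | (e < `|x|)%R])
   ((6 * v / e ^+ 2)%:E * (normal_pdf 0 (2 * Num.sqrt v) x)%:E))%E).
  apply: ge0_le_integral.
  - exact: measurable_norm_gt.
  - by move=> x _; rewrite lee_fin normal_pdf_ge0.
  - by apply/measurable_EFinP/measurable_funTS; exact: measurable_normal_pdf.
  - apply: measurable_funeM; apply/measurable_EFinP/measurable_funTS.
    exact: measurable_normal_pdf.
  - move=> x /= ex; rewrite -EFinM lee_fin.
    by have := normal_pdf_tail s0 e0 ex; rewrite sqr_sqrtr.
have c0 : 0 <= 6 * v / e ^+ 2 by apply: divr_ge0; [exact: mulr_ge0|exact: sqr_ge0].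
rewrite ge0_integralZl//; first last.
- by move=> x _; rewrite lee_fin normal_pdf_ge0.
- by apply/measurable_EFinP/measurable_funTS; exact: measurable_normal_pdf.
- exact: measurable_norm_gt.
rewrite -[leRHS]mule1 lee_wpmul2l ?lee_fin//.
exact: (probability_le1 (normal_prob 0 (2 * Num.sqrt v)) (measurable_norm_gt e)).
Qed.

End gaussian_tail.

(** * Mean, variance and squared distance in L^2(P) *)

Section square_integrable.
Context d (T : measurableType d) (R : realType) (P : probability T R).
Implicit Types f g : T -> R.

Lemma Lfun2_Lfun1 f : f \in Lfun P 2%:E -> f \in Lfun P 1.
Proof. by apply: Lfun_subset12; rewrite fin_num_measure. Qed.

Lemma Lfun2B f g : f \in Lfun P 2%:E -> g \in Lfun P 2%:E ->
  f \- g \in Lfun P 2%:E.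
Proof. by move=> f2 g2; rewrite -[f \- g]/(f - g) rpredB// lee1n. Qed.

Lemma Lfun_measurable q f : f \in Lfun P q -> measurable_fun setT f.
Proof. by move/sub_Lfun_mfun; rewrite inE. Qed.

Lemma meanE f : mean P f = fine 'E_P[f].
Proof. by rewrite unlock. Qed.

Lemma variance_ofE f : variance_of P f = fine 'V_P[f].
Proof.
rewrite /variance_of /mean /Rintegral /variance unlock unlock.
by congr (fine _); apply: eq_integral => x _; rewrite expr2.
Qed.

Lemma variance_le_integral_sqr f : f \in Lfun P 2%:E ->
  ('V_P[f] <= \int[P]_x (f x ^+ 2)%:E)%E.
Proof.
move=> f2; have -> : (\int[P]_x (f x ^+ 2)%:E)%E = 'E_P[f ^+ 2]%E by rewrite unlock.
rewrite varianceE// leeBlDr//; last first.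
  by rewrite fin_numX// expectation_fin_num// Lfun2_Lfun1.
by rewrite leeDl// sqre_ge0.
Qed.

Lemma integral_sqrB_le f g h :
    f \in Lfun P 2%:E -> g \in Lfun P 2%:E -> h \in Lfun P 2%:E ->
  (\int[P]_x ((f x - g x) ^+ 2)%:E <=
   2%:E * (\int[P]_x ((f x - h x) ^+ 2)%:E + \int[P]_x ((g x - h x) ^+ 2)%:E))%E.
Proof.
move=> /Lfun_measurable mf /Lfun_measurable mg /Lfun_measurable mh.
have ms (a b : T -> R) : measurable_fun setT a -> measurable_fun setT b ->
    measurable_fun setT (fun x => ((a x - b x) ^+ 2)%:E).
  by move=> ma mb; apply/measurable_EFinP/measurable_funX/measurable_funB.
have s0 (a b : T -> R) x : (0 <= ((a x - b x) ^+ 2)%:E)%E by rewrite lee_fin sqr_ge0.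
rewrite -ge0_integralD//; [|exact: ms..].
rewrite -ge0_integralZl//; first last.
- by move=> x _; rewrite adde_ge0.
- by apply: emeasurable_funD; exact: ms.
apply: ge0_le_integral => //.
- exact: ms.
- by apply: measurable_funeM; apply: emeasurable_funD; exact: ms.
- move=> x _; rewrite -EFinD -EFinM lee_fin.
  (* With [a = f x - h x] and [b = g x - h x], the gap [2 (a^2 + b^2) - (a - b)^2] is
     [(a + b)^2]. *)
  have := sqr_ge0 ((f x - h x) + (g x - h x)); nra.
Qed.

End square_integrable.

(** * Outer probability and Markov's inequality for outer expectations *)

Section outer_probability.
Context d (Om : measurableType d) (R : realType) (Pr : probability Om R).
Local Open Scope ereal_scope.

Lemma outer_probability_le : {homo outer_probability Pr : A B / A `<=` B >-> A <= B}.
Proof. by move=> A B; exact: le_mu_ext. Qed.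

Lemma outer_probability0 : outer_probability Pr set0 = 0.
Proof. exact: outer_measure0. Qed.

Lemma outer_probability_ge0 A : 0 <= outer_probability Pr A.
Proof. exact: outer_measure_ge0. Qed.

Lemma outer_probabilityU A B :
  outer_probability Pr (A `|` B) <= outer_probability Pr A + outer_probability Pr B.
Proof. exact: outer_measureU2. Qed.

(** The ordinary Markov inequality holds for each integrable majorant [U] of [Z], whose measurable
    set [c <= U] contains [A]; the infimum over [U] then gives the claim. *)
Lemma outer_markov (c : R) (A : set Om) (Z : Om -> R) : (0 < c)%R ->
  (forall w, 0 <= Z w)%R -> (forall w, A w -> c <= Z w)%R ->
  c%:E * outer_probability Pr A <= outer_expectation Pr Z.
Proof.
move=> c0 Z0 AZ; apply: le_ereal_inf_tmp => _ [U [Uint ZU] <-].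
have U0 w : 0 <= U w by apply: le_trans (ZU w); rewrite lee_fin.
have mU : measurable_fun setT U by exact: measurable_int Uint.
have mcU : measurable (setT `&` [set w | c%:E <= `|U w|]).
  by apply: emeasurable_fun_c_infty => //; exact: measurableT_comp.
have := le_integral_abse Pr measurableT mU c0.
rewrite (eq_integral U); last by move=> w _; rewrite gee0_abs.
apply: le_trans; rewrite lee_pmul2l// -[leRHS]measurable_mu_extE//.
apply: outer_probability_le => w Aw; split => //=; rewrite gee0_abs//.
by apply: le_trans (ZU w); rewrite lee_fin AZ.
Qed.

End outer_probability.

(** * Moments of i.i.d. sums and Chebyshev's inequality *)

Section iid.
Context d (Om : measurableType d) (R : realType) (Pr : probability Om R).
Context dT (T : measurableType dT) (P : probability T R).
Variable X : nat -> {RV Pr >-> T}.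
Hypothesis X_iid : iid_sample P X.

Lemma distribution_iid i (A : set T) : measurable A -> distribution Pr (X i) A = P A.
Proof. by case: X_iid => + _; apply. Qed.

Lemma ge0_integral_iid i (f : T -> \bar R) :
  measurable_fun setT f -> (forall x, 0 <= f x)%E ->
  (\int[Pr]_w f (X i w) = \int[P]_x f x)%E.
Proof.
move=> mf f0; rewrite -[LHS](ge0_integral_distribution (X i) mf f0).
by apply: eq_measure_integral => A mA _; exact: distribution_iid.
Qed.

Lemma Lfun2_iid i (f : T -> R) : f \in Lfun P 2%:E -> f \o X i \in Lfun Pr 2%:E.
Proof.
move=> /[dup] /Lfun_measurable mf; rewrite inE => /andP[_ /[!inE] fin].
apply/andP; split; rewrite inE/=; first exact: measurableT_comp.
move: fin; rewrite /finite_norm/= unlock.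
rewrite -(@ge0_integral_iid i (fun x => `|(f x)%:E| `^ 2)%E)//.
- apply: (measurableT_comp (measurable_poweR _)).
  by apply: measurableT_comp => //; exact/measurable_EFinP.
- by move=> x; rewrite poweR_ge0.
Qed.

Lemma expectation_iid i (f : T -> R) : f \in Lfun P 1 -> ('E_Pr[f \o X i] = 'E_P[f])%E.
Proof.
move=> /Lfun1_integrable /[dup] /measurable_int mf fint; rewrite unlock.
rewrite [LHS]integralE [RHS]integralE; congr (_ - _)%E.
- transitivity (\int[Pr]_x ((EFin \o f)^\+ \o X i) x)%E.
    by apply: eq_integral => x _; rewrite -funepos_comp.
  by apply: ge0_integral_iid => //; exact: measurable_funepos.
- transitivity (\int[Pr]_x ((EFin \o f)^\- \o X i) x)%E.
    by apply: eq_integral => x _; rewrite -funeneg_comp.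
  by apply: ge0_integral_iid => //; exact: measurable_funeneg.
Qed.

Lemma expectation_sqr_iid i (f : T -> R) : f \in Lfun P 2%:E ->
  ('E_Pr[(f \o X i) ^+ 2] = 'E_P[f ^+ 2])%E.
Proof.
move=> f2; rewrite -(@expectation_iid i (f ^+ 2))//.
exact: Lfun2_mul_Lfun1.
Qed.

Lemma variance_iid i (f : T -> R) : f \in Lfun P 2%:E -> ('V_Pr[f \o X i] = 'V_P[f])%E.
Proof.
move=> f2; rewrite !varianceE ?Lfun2_iid// expectation_sqr_iid// expectation_iid//.
exact: Lfun2_Lfun1.
Qed.

Lemma joint_distribution_iid i j (A B : set T) :
  i != j -> measurable A -> measurable B ->
  (Pr (X i @^-1` A `&` X j @^-1` B) = P A * P B)%E.
Proof.
move=> ij mA mB; case: X_iid => XE.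
(* Independence takes one family of sets over all indices: [A] at [i] and [B] elsewhere, so [i != j]
   is what puts [B] at [j]. *)
move=> /(_ [fset i; j]%fset (fun k => if k == i then A else B)) h.
transitivity (Pr (\bigcap_(k in [set` [fset i; j]%fset])
    X k @^-1` (if k == i then A else B))).
  congr (Pr _); apply/seteqP; split => w.
    by move=> [Ai Bj] k /=; rewrite !inE; case: eqVneq => [-> _//|_ /= /eqP ->].
  move=> h'; split; first by have := h' i; rewrite /= !inE !eqxx; apply.
  by have := h' j; rewrite /= !inE !eqxx orbT eq_sym (negbTE ij); apply.
rewrite h; last by move=> k; case: ifP.
rewrite big_fsetU1/= ?inE// big_seq_fset1 eqxx eq_sym (negbTE ij).
by congr (_ * _)%E; exact: XE.
Qed.

(** The pair [(X i, X j)] has law [P \x P], because the two measures agree on rectangles; Fubini's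
    theorem then factors the integral. *)
Lemma expectation_prod_iid i j (f : T -> R) : i != j -> f \in Lfun P 2%:E ->
  ('E_Pr[(f \o X i) * (f \o X j)] = 'E_P[f] * 'E_P[f])%E.
Proof.
move=> ij f2; have f1 := Lfun2_Lfun1 f2.
have mf := Lfun_measurable f2.
have fint : P.-integrable setT (EFin \o f) by exact/Lfun1_integrable.
pose XX w := (X i w, X j w).
have mXX : measurable_fun setT XX by exact: measurable_fun_pair.
pose ff (z : T * T) := (f z.1 * f z.2)%:E.
have mff : measurable_fun setT ff.
  by apply/measurable_EFinP/measurable_funM; apply: measurableT_comp.
have eqXX : forall A, measurable A -> (P \x P)%E A = pushforward Pr XX A.
  pose XXrv : {RV Pr >-> (T * T)%type} := 
    HB.pack XX (isMeasurableFun.Build _ _ _ _ XX mXX).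
  move=> A mA.
  apply: (@product_measure_unique _ _ _ _ _ P P (distribution Pr XXrv)) => //.
  move=> B C mB mC.
  exact: joint_distribution_iid.
have iff : (P \x P)%E.-integrable setT ff.
  apply/integrable12ltyP => //.
  under eq_integral => x _.
    under eq_integral => y _ do rewrite /ff/= normrM EFinM.
    rewrite ge0_integralZl//=; last first.
      by apply/measurable_EFinP/measurableT_comp.
    over.
  rewrite ge0_integralZr//=; last 2 first.
    by apply/measurable_EFinP/measurableT_comp.
    exact: integral_ge0.
  case/integrableP: fint => _ fo.
  by rewrite lte_mul_pinfty ?integral_ge0// ge0_fin_numE ?integral_ge0.
rewrite unlock.
transitivity (\int[(P \x P)%E]_z ff z)%E.
  rewrite (eq_measure_integral (pushforward Pr XX)); last by move=> A mA _; exact: eqXX.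
  rewrite integral_pushforward//=.
  have : (((f \o X i) \* (f \o X j)) \in Lfun Pr 1).
    by apply: Lfun2_mul_Lfun1; exact: Lfun2_iid.
  by move/Lfun1_integrable.
rewrite -integral12_prod_meas1//.
transitivity (\int[P]_x ((f x)%:E * \int[P]_y (f y)%:E))%E.
  apply: eq_integral => x _; rewrite -integralZl//.
have fin := integrable_fin_num measurableT fint.
by rewrite -(fineK fin) integralZr ?fineK.
Qed.


Lemma covariance_iid i j (f : T -> R) : i != j -> f \in Lfun P 2%:E ->
  covariance Pr (f \o X i) (f \o X j) = 0%E.
Proof.
move=> ij f2; have fX2 k := Lfun2_iid k f2; have f1 := Lfun2_Lfun1 f2.
rewrite covarianceE ?Lfun2_mul_Lfun1 ?Lfun2_Lfun1//.
rewrite expectation_prod_iid// !expectation_iid// subee//.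
by rewrite fin_numM// expectation_fin_num.
Qed.

Let partial_sum (f : T -> R) n : Om -> R := \sum_(i < n) (f \o X i).

Lemma Lfun2_partial_sum f n : f \in Lfun P 2%:E -> partial_sum f n \in Lfun Pr 2%:E.
Proof.
move=> f2; rewrite /partial_sum; elim: n => [|n IH].
  by rewrite big_ord0; exact: Lfun_cst.
rewrite big_ord_recr; have [_] := Lfun_addr_closed Pr (lee1n 2).
by apply => //; exact: Lfun2_iid.
Qed.

Lemma covariance_partial_sum f n j : (n <= j)%N -> f \in Lfun P 2%:E ->
  covariance Pr (partial_sum f n) (f \o X j) = 0%E.
Proof.
move=> + f2; elim: n => [|n IH] nj.
  by rewrite /partial_sum big_ord0; exact: covariance_cst_l.
rewrite /partial_sum big_ord_recr/= covarianceDl ?Lfun2_partial_sum ?Lfun2_iid//.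
by rewrite IH ?(ltnW nj)// add0e covariance_iid// ltn_eqF.
Qed.

Lemma expectation_partial_sum f n : f \in Lfun P 2%:E ->
  ('E_Pr[partial_sum f n] = n%:R%:E * 'E_P[f])%E.
Proof.
move=> f2; have f1 := Lfun2_Lfun1 f2; elim: n => [|n IH].
  by rewrite /partial_sum big_ord0 mul0e; exact: expectation_cst.
rewrite /partial_sum big_ord_recr/= expectationD; last 2 first.
- by apply: Lfun2_Lfun1; exact: Lfun2_partial_sum.
- by apply: Lfun2_Lfun1; exact: Lfun2_iid.
by rewrite IH expectation_iid// -natr1 EFinD ge0_muleDl// ?lee_fin// mul1e.
Qed.

Lemma variance_partial_sum f n : f \in Lfun P 2%:E ->
  ('V_Pr[partial_sum f n] = n%:R%:E * 'V_P[f])%E.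
Proof.
move=> f2; elim: n => [|n IH].
  by rewrite /partial_sum big_ord0 mul0e; exact: variance_cst.
rewrite /partial_sum big_ord_recr/= varianceD ?Lfun2_partial_sum ?Lfun2_iid//.
rewrite covariance_partial_sum// mule0 adde0 IH variance_iid//.
by rewrite -natr1 EFinD ge0_muleDl// ?lee_fin// mul1e.
Qed.

(** The bound is uniform in [n]: Chebyshev's inequality is applied to the partial sum at level
    [e * sqrt n], and the variance [n * V(f)] of the sum cancels the factor [n] of the squared
    level. *)
Lemma emp_process_chebyshev f n (e : R) : f \in Lfun P 2%:E -> 0 < e ->
  (outer_probability Pr [set w | (e <= `|emp_process P X n w f|)%R] <=
   (e ^- 2)%:E * 'V_P[f])%E.
Proof.
move=> f2 e0.
have rhs0 : (0 <= (e ^- 2)%:E * 'V_P[f])%E.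
  by rewrite mule_ge0 ?variance_ge0// lee_fin invr_ge0 sqr_ge0.
(* At [n = 0] the factor [sqrt n] makes the empirical process vanish, so the event is empty. *)
case: (posnP n) => [->|n0].
  have -> : [set w | e <= `|emp_process P X 0 w f|] = set0.
    apply/seteqP; split => // w /=.
    by rewrite /emp_process sqrtr0 mul0r normr0 leNgt e0.
  by rewrite outer_probability0.
have sn0 : 0 < Num.sqrt n%:R :> R by rewrite sqrtr_gt0 ltr0n.
have mS : measurable_fun setT (partial_sum f n).
  by apply: Lfun_measurable; exact: Lfun2_partial_sum.
pose S : {RV Pr >-> R} :=
  HB.pack (partial_sum f n) (isMeasurableFun.Build _ _ _ _ _ mS).
have := @chebyshev _ _ _ Pr S (e * Num.sqrt n%:R) (mulr_gt0 e0 sn0).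
have -> : (((e * Num.sqrt n%:R) ^- 2)%:E * 'V_Pr[S] = (e ^- 2)%:E * 'V_P[f])%E.
  rewrite variance_partial_sum// muleA -EFinM; congr (_%:E * _)%E.
  by rewrite exprMn sqr_sqrtr// invfM mulfVK// pnatr_eq0 -lt0n.
apply: le_trans; rewrite -[leRHS]measurable_mu_extE; last first.
  have -> : [set x | e * Num.sqrt n%:R <= `|S x - fine 'E_Pr[S]|] =
      (fun x => `|S x - fine 'E_Pr[S]|) @^-1` [set` `[e * Num.sqrt n%:R, +oo[].
    by apply/seteqP; split => x /=; rewrite in_itv/= andbT.
  rewrite -[X in measurable X]setTI; apply: measurableT_comp => //.
  exact: measurable_funB.
apply: outer_probability_le => w /= ew.
rewrite expectation_partial_sum// fineM//=; last first.
  by rewrite expectation_fin_num// Lfun2_Lfun1.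
rewrite -meanE.
have -> : partial_sum f n w - n%:R * mean P f = emp_process P X n w f * Num.sqrt n%:R.
  rewrite /emp_process /emp_mean /partial_sum fct_sumE mulrAC -expr2 sqr_sqrtr//.
  by rewrite mulrBr mulrA mulfV ?mul1r// pnatr_eq0 -lt0n.
by rewrite normrM (ger0_norm (ltW sn0)) ler_wpM2r// ltW.
Qed.
End iid.

(** * Finite colourings and continuous functionals on l^oo(F) *)

Lemma bounded_coloring (U : Type) (V : eqType) (R : realType) (app : V -> U -> R)
    (F : set U) (s : seq V) (e : R) : 0 < e ->
  (forall z, z \in s -> exists M, forall f, F f -> `|app z f| <= M) ->
  exists (I : finType) (c : U -> I), forall z f g, z \in s -> F f -> F g ->
    c f = c g -> `|app z f - app z g| <= e.
Proof.
move=> e0; elim: s => [_|z0 s IH bs].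
  by exists unit, (fun=> tt).
have [z zs|I [c cP]] := IH; first by apply: bs; rewrite inE zs orbT.
have [|M Mz0] := bs z0; first by rewrite mem_head.
(* The extra component of the colour is the cell of width [e] of [[-M, M]] that contains the value
   at [z0]. On [F] the index of the cell is at most [truncn (2 * M / e)], so [inord] does not alter
   it. *)
pose q f := Num.truncn ((app z0 f + M) / e).
exists (I * 'I_(Num.truncn (2 * M / e)).+1)%type, (fun f => (c f, inord (q f))).
move=> z f g; rewrite inE => /orP[/eqP ->|zs] Ff Fg [cfg qfg]; last exact: cP.
have qI h : F h -> ((q h < (Num.truncn (2 * M / e)).+1)%N *
    ((q h)%:R <= (app z0 h + M) / e < (q h).+1%:R)).
  move=> /Mz0; rewrite ler_norml => /andP[Mh hM]; split.
    by rewrite ltnS le_truncn// ler_pM2r ?invr_gt0//; lra.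
  by apply: truncn_itv; apply: divr_ge0; [lra|exact: ltW].
move: qfg => /(congr1 val); rewrite /= !inordK ?qI// => qfg.
have /andP[] := (qI _ Ff).2; rewrite ler_pdivlMr// ltr_pdivrMr//.
have /andP[] := (qI _ Fg).2; rewrite ler_pdivlMr// ltr_pdivrMr// qfg -natr1.
by rewrite ler_norml; lra.
Qed.

Section linfty.
Context (R : realType) d (T : measurableType d) (F : set (T -> R)).
Local Notation linf := {uniform` F -> R}.

Lemma nbhs_uniform (z : linf) (e : R) : 0 < e ->
  nbhs z [set z' : linf | forall f, F f -> `|z f - z' f| < e].
Proof.
move=> e0; apply/uniform_nbhs; exists [set xy | ball xy.1 e xy.2]; split => //.
by apply: (entourage_ball _ (PosNum e0)).
Qed.

(** Total boundedness in the style of Arzela-Ascoli: finitely many uniform balls of radius [e / 3]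
    cover [K], and functions are coloured by their values at the centres up to [e / 3]. Passing from
    [z] to a centre and back costs the other two thirds. *)
Lemma compact_coloring (K : set linf) (e : R) : 0 < e ->
  K `<=` @linfty _ _ _ F -> compact K ->
  exists (I : finType) (c : (T -> R) -> I), forall z f g, K z -> F f -> F g ->
    c f = c g -> `|z f - z g| <= e.
Proof.
move=> e0 Kb; have e30 : 0 < e / 3 by rewrite divr_gt0.
pose B (k : linf) := [set z : linf | forall f, F f -> `|k f - z f| < e / 3].
(* An arbitrary base point, so that [compact_cover] applies. *)
pose linfP : ptopologicalType := HB.pack linf (isPointed.Build linf (fun=> 0)).
move=> cK; have : @compact linfP K by exact: cK.
rewrite compact_cover => /(_ _ K (fun k => (B k)^°)) [||D DK KD].
- by move=> k _; exact: open_interior.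
- by move=> z Kz; exists z => //; apply: nbhs_uniform.
have [|I [c cP]] := @bounded_coloring _ linf R (fun z => z) F (enum_fset D) _ e30.
  by move=> z zD; apply: Kb; rewrite -[K z]inE; apply: DK.
exists I, c => z f g Kz Ff Fg cfg.
have [k /= kD /interior_subset kz] := KD _ Kz.
have := cP _ _ _ kD Ff Fg cfg; have := kz _ Ff; have := kz _ Fg.
rewrite !ltr_norml !ler_norml; lra.
Qed.

Lemma continuous_linfty_measurable (G : linf -> R) : continuous G ->
  measurable_fun setT (G : linfty_borel F -> R).
Proof.
move=> /continuousP cG; apply: (measurability _ (RGenOpens.measurableE R)).
move=> _ [_ [a [b ->] <-]]; rewrite setTI; apply: sub_sigma_algebra.
exact/cG/interval_open.
Qed.

(** A one-sided bound suffices, since the roles of [z] and [z'] can be exchanged. The constant 2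
    suits functionals of increments [z f - z h], which involve two evaluations. *)
Lemma continuous_linfty_lipschitz (G : linf -> R) :
  (forall (z z' : linf) e, 0 < e -> (forall f, F f -> `|z f - z' f| < e) ->
     G z <= G z' + 2 * e) -> continuous G.
Proof.
move=> Glip z A /nbhs_ballP[e /= e0 eA].
have e30 : 0 < e / 3 by exact: divr_gt0.
have := nbhs_uniform z e30; apply: (@filterS _ _ (nbhs_filter z)) => z' zz'.
have := Glip z z' _ e30 zz'.
have zz'C f : F f -> `|z' f - z f| < e / 3 by move=> /zz'; rewrite distrC.
have := Glip z' z _ e30 zz'C.
move=> h1 h2; apply: eA; rewrite /ball/= ltr_norml; lra.
Qed.

Lemma continuous_linfty_eval f : F f -> continuous (fun z : linf => z f).
Proof.
move=> Ff; apply: continuous_linfty_lipschitz => z z' e e0 /(_ _ Ff).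
rewrite ltr_norml; lra.
Qed.

(** Truncating at [c] inside the supremum keeps the set bounded for every [z], even one unbounded on
    [F], and makes the functional bounded, hence a legitimate test function for weak convergence. *)
Definition oscillation (B : set (T -> R)) (h : T -> R) (c : R)
    (z : (T -> R) -> R) : R :=
  sup [set Num.min c `|z f - z h| | f in B].

Section oscillation.
Variables (B : set (T -> R)) (h : T -> R) (c : R).
Hypotheses (BF : B `<=` F) (Bh : B h).

Lemma oscillation_ge z f : B f -> Num.min c `|z f - z h| <= oscillation B h c z.
Proof.
move=> Bf; apply: ub_le_sup; last by exists f.
by exists c => _ [g _ <-]; rewrite ge_min lexx.
Qed.

Lemma oscillation_le z M :
  (forall f, B f -> Num.min c `|z f - z h| <= M) -> oscillation B h c z <= M.
Proof.
move=> BM; apply: ge_sup; first by exists (Num.min c `|z h - z h|), h.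
by move=> _ [f Bf <-]; exact: BM.
Qed.

Lemma oscillation_itv z : 0 <= c -> 0 <= oscillation B h c z <= c.
Proof.
move=> c0; apply/andP; split.
  by apply: le_trans (oscillation_ge z Bh); rewrite le_min c0 normr_ge0.
by apply: oscillation_le => f _; rewrite ge_min lexx.
Qed.

Lemma continuous_oscillation : continuous (oscillation B h c : linf -> R).
Proof.
apply: continuous_linfty_lipschitz => z z' e e0 zz'.
apply: oscillation_le => f Bf.
(* Truncation at [c] is 1-Lipschitz, and the increment from [h] to [f] changes by less than
   [2 * e]. *)
apply: (@le_trans _ _ (Num.min c `|z' f - z' h| + 2 * e)).
  have := zz' _ (BF Bf); have := zz' _ (BF Bh); rewrite !ltr_norml => hh hf.
  rewrite -lerBlDr le_min !lerBlDr ge_min; apply/andP; split.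
    by apply/orP; left; lra.
  rewrite ge_min; apply/orP; right.
  have := ler_norm (z' f - z' h); have := ler_norm (- (z' f - z' h)).
  rewrite normrN ler_norml; lra.
by rewrite lerD2r; exact: oscillation_ge.
Qed.

End oscillation.
End linfty.

(** * Union bound, increments and oscillation of the Brownian bridge *)

Lemma measure_bigsetU_le d (T : measurableType d) (R : realType)
    (mu : {measure set T -> \bar R}) (I : finType) (A : I -> set T) :
  (forall i, measurable (A i)) ->
  measurable (\big[setU/set0]_i A i) /\
  (mu (\big[setU/set0]_i A i) <= \sum_i mu (A i))%E.
Proof.
move=> mA.
elim/big_ind2 : _ => [|B x C y [mB Bx] [mC Cy]|i _]; last by split.
  by rewrite measure0.
split; first exact: measurableU.
by apply: le_trans (measureU2 _ mB mC) _; exact: leeD.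
Qed.

Section brownian_bridge.
Context d (T : measurableType d) (R : realType) (P : probability T R).
Variable F : set (T -> R).
Local Notation linf := {uniform` F -> R}.
Hypothesis F2 : forall f, F f -> f \in Lfun P 2%:E.
Variable L : probability (linfty_borel F) R.

Lemma open_linfty_borel (A : set linf) :
  open A -> measurable (A : set (linfty_borel F)).
Proof. exact: sub_sigma_algebra. Qed.

(** The set is open: a uniform perturbation of size 1 on [F] raises a bound by at most 1. *)
Lemma measurable_linfty : measurable (@linfty _ _ _ F : set (linfty_borel F)).
Proof.
apply: open_linfty_borel; rewrite openE => z [M Mz].
apply: (@filterS _ _ (nbhs_filter z) _ _ _ (nbhs_uniform z (@ltr01 R))) => z' zz'.
exists (M + 1) => f Ff; have := zz' _ Ff; have := Mz _ Ff.
rewrite !ler_norml ltr_norml; lra.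
Qed.

Lemma measurable_increment f g (e : R) : F f -> F g ->
  measurable ([set z : linf | e < `|z f - z g|] : set (linfty_borel F)).
Proof.
move=> Ff Fg.
have meval k : F k -> measurable_fun setT (fun z : linfty_borel F => z k).
  move=> Fk; apply: (continuous_linfty_measurable (G := fun z => z k)).
  exact: continuous_linfty_eval.
have m : measurable_fun setT (fun z : linfty_borel F => z f - z g).
  by apply: measurable_funB; exact: meval.
rewrite -[X in measurable X]setTI.
by apply: (m measurableT _ (measurable_norm_gt e)).
Qed.

Hypothesis L_bridge : brownian_bridge_law P L.

(** The increment is the linear combination with coefficients 1 and -1, so it is Gaussian with the
    variance of [f - g], which the squared L^2 distance dominates. *)
Lemma brownian_bridge_increment f g (e : R) : F f -> F g -> 0 < e ->
  (L [set z : linf | e < `|z f - z g|]%R <=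
   (6 / e ^+ 2)%:E * \int[P]_x ((f x - g x) ^+ 2)%:E)%E.
Proof.
move=> Ff Fg e0.
have fg2 := Lfun2B (F2 Ff) (F2 Fg).
have := L_bridge (k := 2) (f := fun i => if i == ord0 then f else g)
  (fun i => if i == ord0 then 1 else -1) _ (measurable_norm_gt e).
have -> : [set z : linf | [set x | e < `|x|]
    (\sum_(i < 2) (if i == ord0 then 1 else -1) * z (if i == ord0 then f else g))] =
    [set z | e < `|z f - z g|].
  by apply/seteqP; split => z /=; rewrite big_ord_recl big_ord1/= mul1r mulN1r.
have -> : (fun x => \sum_(i < 2) (if i == ord0 then 1 else -1) *
    (if i == ord0 then f else g) x) = f \- g.
  by apply/funext => x; rewrite big_ord_recl big_ord1/= mul1r mulN1r.
move=> ->; last by move=> i; case: ifP.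
rewrite variance_ofE; apply: (le_trans (centered_gaussian_tail _ e0)).
  by rewrite fine_ge0// variance_ge0.
rewrite mulrAC EFinM fineK ?variance_fin_num// lee_wpmul2l//.
  by rewrite lee_fin divr_ge0 ?sqr_ge0.
exact: variance_le_integral_sqr.
Qed.

Variable f0 : T -> R.
Hypothesis f02 : f0 \in Lfun P 2%:E.

(** The radius is on the squared scale, that of the variance bounds and of the consistency
    condition. *)
Definition L2_ball (r : R) : set (T -> R) :=
  [set f | F f /\ (\int[P]_x ((f x - f0 x) ^+ 2)%:E <= r%:E)%E].

Hypothesis L_tight : tight_law L.

(* Functions of the same colour are [e]-close on the compact set [K], so up to
   [e] the oscillation over the ball on [K] only involves one representative per
   colour; as the number of colours is fixed before the radius, the union bound
   over the representatives is harmless. *)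
Lemma integral_oscillation_small (c eta : R) : 0 < c -> 0 < eta ->
  exists2 delta : R, 0 < delta & forall r h, r <= delta -> L2_ball r h ->
    (\int[L]_(z in linfty (F := F)) (oscillation (L2_ball r) h c z)%:E <= eta%:E)%E.
Proof.
move=> c0 eta0.
(* The final bound is [2 * e + c * (2 * (e / c))], that is [4 * e]. *)
pose e := eta / 4; have e0 : 0 < e by rewrite divr_gt0.
have [K [KF clK cK LK]] := L_tight (divr_gt0 e0 c0).
have mK : measurable (K : set (linfty_borel F)).
  rewrite -[K]setCK; apply: measurableC; apply: open_linfty_borel.
  exact: closed_openC.
have LKC : (L (~` K) <= (e / c)%:E)%E.
  rewrite probability_setC//.
  by rewrite leeBlDr ?fin_num_measure//; move: LK; rewrite leeBlDl.
have [I [col colP]] := compact_coloring e0 KF cK.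
pose N : R := #|I|.+1%:R.
have N0 : 0 < N by rewrite ltr0n.
(* A representative and [h] both lie within [delta] of [f0], hence within [4 * delta] of each other
   in squared distance; this choice makes the increment bound [6 / e^2 * (4 * delta)] equal to
   [e / c / N]. *)
pose delta := e / c / N / (24 / e ^+ 2).
have delta0 : 0 < delta by rewrite !divr_gt0// exprn_gt0.
exists delta => // r h rd Bh.
(* A colour that does not occur in the ball is represented by [h]. *)
have repE i : exists g, L2_ball r g /\
    forall f, L2_ball r f -> col f = i -> col g = i.
  have [[f [Bf fi]]|nf] := pselect (exists f, L2_ball r f /\ col f = i).
    by exists f.
  by exists h; split => // f Bf fi; exfalso; apply: nf; exists f.
have [rep repP] := choice repE.
pose bad i := [set z : linf | e < `|z (rep i) - z h|] : set (linfty_borel F).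
have Bh' : F h := Bh.1.
have mbad i : measurable (bad i).
  by apply: measurable_increment => //; exact: (repP i).1.1.
have Lbad i : (L (bad i) <= (e / c / N)%:E)%E.
  apply: le_trans (brownian_bridge_increment (repP i).1.1 Bh' e0) _.
  have : (\int[P]_x ((rep i x - h x) ^+ 2)%:E <= (4 * delta)%:E)%E.
    apply: le_trans (integral_sqrB_le (F2 (repP i).1.1) (F2 Bh') f02) _.
    have -> : 4 * delta = 2 * (delta + delta) by ring.
    rewrite EFinM lee_pmul2l// EFinD leeD//.
      by apply: le_trans (repP i).1.2 _; rewrite lee_fin.
    by apply: le_trans Bh.2 _; rewrite lee_fin.
  have e26 : (0 <= (6 / e ^+ 2)%:E)%E by rewrite lee_fin divr_ge0 ?sqr_ge0.
  move=> /(lee_wpmul2l e26) /le_trans; apply.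
  rewrite -EFinM lee_fin le_eqVlt; apply/orP; left; apply/eqP.
  by rewrite /delta; field; rewrite !gt_eqF.
have [mU LU] := measure_bigsetU_le L mbad.
set U := \big[setU/set0]_i bad i in mU LU.
have LU' : (L U <= (e / c)%:E)%E.
  apply: le_trans LU _; apply: (@le_trans _ _ (\sum_(i in I) (e / c / N)%:E)%E).
    by apply: lee_sum => i _; exact: Lbad.
  rewrite sumEFin lee_fin sumr_const -[_ *+ _]mulr_natr.
  by rewrite mulrAC ler_pdivrMr// ler_pM2l ?divr_gt0// ler_nat leqnSn.
pose V := ~` K `|` U.
have mV : measurable (V : set (linfty_borel F)).
  by apply: measurableU => //; exact: measurableC.
have LV : (L V <= (2 * (e / c))%:E)%E.
  apply: le_trans (measureU2 _ (measurableC mK) mU) _.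
  by rewrite mulrDl mul1r EFinD leeD.
(* On [V] only the truncation at [c] is used. Off [V], going from [f] to its representative costs
   [e] by the colouring of [K], and from there to [h] another [e], as no increment is bad. *)
have osc_le z : oscillation (L2_ball r) h c z <= 2 * e + c * \1_V z.
  apply: (oscillation_le Bh) => f Bf; rewrite indicE.
  case: (boolP (z \in V)) => [_|]; rewrite ?mulr1 ?mulr0.
    by rewrite ge_min ler_wpDl// mulr_ge0// ltW.
  rewrite notin_setE => nV; rewrite addr0 ge_min; apply/orP; right.
  have Kz : K z by apply: contrapT => nK; apply: nV; left.
  have nbad : `|z (rep (col f)) - z h| <= e.
    rewrite leNgt; apply/negP => zbad; apply: nV; right.
    by rewrite /U (bigD1 (col f))//=; left.
  have := colP _ _ _ Kz Bf.1 (repP (col f)).1.1 _.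
  rewrite ((repP (col f)).2 f)// => /(_ erefl).
  move: nbad; rewrite !ler_norml; lra.
have osc0 z : (0 <= (oscillation (L2_ball r) h c z)%:E)%E.
  by rewrite lee_fin; have /andP[] := oscillation_itv Bh z (ltW c0).
have mosc : measurable_fun setT (fun z : linfty_borel F =>
    (oscillation (L2_ball r) h c z)%:E).
  apply/measurable_EFinP.
  apply: (continuous_linfty_measurable (G := oscillation (L2_ball r) h c)).
  by apply: continuous_oscillation => // f [].
have mind : measurable_fun setT (fun z : linfty_borel F =>
    (2 * e + c * \1_V z)%:E).
  apply/measurable_EFinP/measurable_funD => //.
  by apply: measurable_funM => //; exact: measurable_indic.
(* The integrand is nonnegative, so the domain may grow to the whole space. *)
apply: (@le_trans _ _ (\int[L]_z (oscillation (L2_ball r) h c z)%:E)%E).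
  by apply: ge0_subset_integral => //; exact: measurable_linfty.
apply: (@le_trans _ _ (\int[L]_z (2 * e + c * \1_V z)%:E)%E).
  by apply: ge0_le_integral => // z _; rewrite lee_fin.
have mV1 : measurable_fun setT (fun z : linfty_borel F => (\1_V z : R)%:E).
  by apply/measurable_EFinP; exact: measurable_indic.
under eq_integral do rewrite EFinD [(c * _)%:E]EFinM.
rewrite ge0_integralD//; last 3 first.
- by move=> z _; rewrite lee_fin mulr_ge0// ltW.
- by move=> z _; rewrite -EFinM lee_fin mulr_ge0// ltW.
- exact: measurable_funeM.
rewrite integral_cst// ge0_integralZl//; last first.
- by rewrite lee_fin ltW.
rewrite integral_indic// setIT.
rewrite [X in ((2 * e)%:E * X + _)%E](_ : _ = 1%E) ?mule1; last exact: probability_setT.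
apply: (@le_trans _ _ ((2 * e)%:E + c%:E * (2 * (e / c))%:E)%E).
  by rewrite leeD2l// lee_wpmul2l// lee_fin ltW.
rewrite -EFinM -EFinD lee_fin le_eqVlt; apply/orP; left; apply/eqP.
by rewrite /e; field; rewrite gt_eqF.
Qed.

End brownian_bridge.

(** * Asymptotic equicontinuity of the empirical process *)

Lemma cvge_near_lt (R : realType) (u : nat -> \bar R) (l a : \bar R) :
  u n @[n --> \oo] --> l -> (l < a)%E -> \forall n \near \oo, (u n < a)%E.
Proof.
move=> ul la; apply: (ul [set y | (y < a)%E]).
by apply: open_nbhs_nbhs; split => //; exact: open_ereal_lt_ereal.
Qed.

Section empirical_process.
Context d (Om : measurableType d) (R : realType) (Pr : probability Om R).
Context dT (T : measurableType dT) (P : probability T R).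
Variable X : nat -> {RV Pr >-> T}.

Lemma emp_processB n w (f g : T -> R) : f \in Lfun P 2%:E -> g \in Lfun P 2%:E ->
  emp_process P X n w (f \- g) = emp_process P X n w f - emp_process P X n w g.
Proof.
move=> /Lfun2_Lfun1 f1 /Lfun2_Lfun1 g1.
rewrite /emp_process /emp_mean sumrB !meanE expectationB// fineB ?expectation_fin_num//.
by ring.
Qed.

Hypothesis X_iid : iid_sample P X.

(** Because the existential quantifier over [f] is inside the event, a data-dependent [f] may be
    substituted at each sample point. *)
Lemma donsker_equicontinuous_at (F : set (T -> R)) (f0 : T -> R) (c eta : R) :
  donsker P F -> f0 \in Lfun P 2%:E -> 0 < c -> 0 < eta ->
  exists2 delta : R, 0 < delta & \forall n \near \oo,
    (outer_probability Pr [set w | exists f,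
      L2_ball P F f0 delta f /\
      (c < `|emp_process P X n w f - emp_process P X n w f0|)%R] <= eta%:E)%E.
Proof.
move=> [F2 _ [L [_ L_tight L_bridge L_cvg]]] f02 c0 eta0.
pose c2 := c / 2; have c20 : 0 < c2 by rewrite divr_gt0.
(* A limit of at most [eta * c2 / 4] leaves a strict margin below [eta * c2 / 2], which Markov's
   inequality at level [c2] turns into [eta / 2]. *)
have [d1 d10 d1P] := integral_oscillation_small F2 L_bridge f02 L_tight c20
  (divr_gt0 (mulr_gt0 eta0 c20) (ltr0n R 4)).
(* The second term makes the Chebyshev bound [delta / c2^2] for the increment from [h] to [f0] at
   most [eta / 2]. *)
pose delta := Num.min d1 (c2 ^+ 2 * (eta / 2)).
have delta0 : 0 < delta.
  by rewrite lt_min d10/= mulr_gt0 ?exprn_gt0// divr_gt0.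
exists delta => //.
have [[h Bh]|nB] := pselect (exists h, L2_ball P F f0 delta h); last first.
  near=> n; rewrite [X in (outer_probability _ X <= _)%E](_ : _ = set0).
    by rewrite outer_probability0 lee_fin ltW.
  by apply/seteqP; split => // w [f [Bf _]]; apply: nB; exists f.
pose H := oscillation (L2_ball P F f0 delta) h c2.
have cvgH := L_cvg _ _ _ _ X_iid H _ _.
have H_small : \forall n \near \oo, (outer_expectation Pr
    (fun w => H (emp_process P X n w)) < (eta * c2 / 2)%:E)%E.
  apply: (cvge_near_lt (cvgH _ _)).
  - apply: continuous_subspaceT; apply: continuous_oscillation => //.
    by move=> f [].
  - exists c2 => z _.
    have /andP[h0 hc] := @oscillation_itv _ _ _ _ _ c2 Bh z (ltW c20).
    by rewrite ger0_norm.
  - apply: le_lt_trans (d1P delta h _ Bh) _; first by rewrite ge_min lexx.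
    rewrite lte_fin ltr_pM2l ?mulr_gt0// ltf_pV2 ?posrE// ltr_nat//.
near=> n.
have Hn : (outer_expectation Pr (fun w => H (emp_process P X n w)) <
    (eta * c2 / 2)%:E)%E by near: n.
pose A := [set w | c2 <= H (emp_process P X n w)].
pose B := [set w | c2 <= `|emp_process P X n w (h \- f0)|].
have h2 := F2 _ Bh.1.
apply: (@le_trans _ _ (outer_probability Pr (A `|` B))).
  apply: outer_probability_le => w [f [Bf cf]].
  (* Since [c = 2 * c2], one of the increments from [f] to [h] and from [h] to [f0] reaches [c2]. *)
  have [fh|fh] := leP c2 `|emp_process P X n w f - emp_process P X n w h|.
    left; apply: le_trans (oscillation_ge h c2 (emp_process P X n w) Bf).
    by rewrite le_min lexx.
  right; rewrite /B/= emp_processB//.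
  move: cf fh; rewrite {1}(_ : c = c2 + c2); last by rewrite /c2 -splitr.
  set x := emp_process _ _ _ _ f; set y := emp_process _ _ _ _ f0.
  set v := emp_process _ _ _ _ h => cf fh.
  have : `|x - y| <= `|x - v| + `|v - y|.
    by have := ler_normD (x - v) (v - y); rewrite addrA subrK.
  lra.
apply: le_trans (outer_probabilityU Pr A B) _.
rewrite [eta]splitr EFinD; apply: leeD.
  rewrite -(@lee_pmul2l _ c2%:E) ?lte_fin//.
  apply: le_trans.
    apply: (@outer_markov _ _ _ Pr c2 A (fun w => H (emp_process P X n w))) => //.
    by move=> w; have /andP[] := oscillation_itv Bh (emp_process P X n w) (ltW c20).
  apply: le_trans (ltW Hn) _; rewrite -EFinM lee_fin; lra.
apply: le_trans (emp_process_chebyshev X_iid n (Lfun2B h2 f02) c20) _.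
apply: le_trans.
  apply: lee_wpmul2l (variance_le_integral_sqr (Lfun2B h2 f02)).
  by rewrite lee_fin invr_ge0 sqr_ge0.
apply: (@le_trans _ _ ((c2 ^- 2)%:E * delta%:E)%E).
  by rewrite lee_wpmul2l ?lee_fin ?invr_ge0 ?sqr_ge0//; exact: Bh.2.
rewrite -EFinM lee_fin mulrC ler_pdivrMr ?exprn_gt0// mulrC.
by rewrite ge_min lexx orbT.
Unshelve. all: by end_near. Qed.

End empirical_process.

(** * Convergence in probability and the final expansion *)

Lemma cvge0P (R : realType) (u : nat -> \bar R) : (forall n, 0 <= u n)%E ->
  (u n @[n --> \oo] --> 0%E) <->
  (forall eta : R, 0 < eta -> \forall n \near \oo, (u n <= eta%:E)%E).
Proof.
move=> u0; split=> [ul eta eta0|ul].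
  have := @cvge_near_lt _ u 0%E eta%:E ul; rewrite lte_fin => /(_ eta0).
  by apply: filterS => n /ltW.
apply/fine_cvgP; split.
  apply: filterS (ul 1 ltr01) => n un.
  by rewrite ge0_fin_numE// (le_lt_trans un)// ltry.
apply/cvgrPdist_le => e e0; apply: filterS (ul e e0) => n un /=.
rewrite sub0r normrN ger0_norm ?fine_ge0//.
by rewrite -lee_fin fineK// ge0_fin_numE// (le_lt_trans un)// ltry.
Qed.

Theorem theorem2 (R : realType) (p : nat) (d : measure_display)
  (Om : measurableType d) (Pr : probability Om R)
  (P0 : probability (obs R p) R) (X : nat -> {RV Pr >-> obs R p})
  (Qstar : nat -> Om -> bool -> p.-tuple R -> R)
  (gstar : nat -> Om -> p.-tuple R -> R)
  (Pstar : nat -> Om -> probability (obs R p) R)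
  (D0 : obs R p -> R) (Dstar : nat -> Om -> obs R p -> R)
  (X_iid : iid_sample P0 X)
  (P0_model : in_model P0)
  (D0_eif : efficient_influence_function (@Sigma2 R p) P0 D0)
  (Pstar_targeted : forall n w, (0 < n)%N ->
    targeted_distribution X n w (Qstar n w) (gstar n w) (Pstar n w))
  (Pstar_model : forall n w, (0 < n)%N -> in_model (Pstar n w))
  (Dstar_eif : forall n w, (0 < n)%N ->
    efficient_influence_function (@Sigma2 R p) (Pstar n w) (Dstar n w))
  (eif_equation : small_oP Pr (root_n_rate R)
    (fun n w => emp_mean X n w (Dstar n w)))
  (donsker_condition : exists F : set (obs R p -> R), donsker P0 F /\
    outer_probability Pr [set w | ~ F (Dstar n w)] @[n --> \oo] --> 0%E)
  (remainder_condition : small_oP Pr (root_n_rate R)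
    (fun n w => second_order_remainder (@Sigma2 R p) (Pstar n w) P0 (Dstar n w)))
  (consistency : cvg0_in_probability Pr
    (fun n w => (\int[P0]_o ((Dstar n w o - D0 o) ^+ 2)%:E)%E)) :
  asymptotically_efficient X (@Sigma2 R p) P0
    (fun n w => fine (Sigma2 (Pstar n w))) D0.
Proof.
split=> // e e0; apply/cvge0P; first by move=> n; exact: outer_probability_ge0.
move=> eta eta0.
have [_ [D02 D0mean] _] := D0_eif.
have [F [F_donsker F_cvg]] := donsker_condition.
(* Five exceptional events share [eta], and three terms of the decomposition share [e]. *)
have eta5 : 0 < eta / 5 by rewrite divr_gt0.
have e3 : 0 < e / 3 by rewrite divr_gt0.
have [delta delta0 equi] :=
  donsker_equicontinuous_at X_iid F_donsker D02 e3 eta5.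
have ge0 (A : nat -> set Om) n : (0 <= outer_probability Pr (A n))%E.
  exact: outer_probability_ge0.
have H1 := (cvge0P (ge0 _)).1 (eif_equation _ e3) _ eta5.
have H2 := (cvge0P (ge0 _)).1 (remainder_condition _ e3) _ eta5.
have H3 := (cvge0P (ge0 _)).1 (consistency _ delta0) _ eta5.
have H4 := (cvge0P (ge0 _)).1 F_cvg _ eta5.
apply: filterS (filterI equi (filterI H1 (filterI H2 (filterI H3 H4)))) => n.
move=> [+ [+ [+ [+ +]]]].
set A0 := (X in outer_probability _ X) => A0_le.
set A1 := (X in outer_probability _ X) => A1_le.
set A2 := (X in outer_probability _ X) => A2_le.
set A3 := (X in outer_probability _ X) => A3_le.
set A4 := (X in outer_probability _ X) => A4_le.
(* In order, these are the failures of equicontinuity, of the estimating equation, of the remainder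
   bound, of consistency and of membership in [F]. Outside all five, [Dstar n w] lies in the ball
   around [D0] and the three terms are at most [e / 3]. *)
apply: (@le_trans _ _ (outer_probability Pr (A0 `|` (A1 `|` (A2 `|` (A3 `|` A4)))))).
  apply: outer_probability_le => w /=; rewrite lte_fin => ew.
  apply: contrapT => nA.
  have nA0 : ~ A0 w by move=> h; apply: nA; left.
  have nA1 : ~ A1 w by move=> h; apply: nA; right; left.
  have nA2 : ~ A2 w by move=> h; apply: nA; right; right; left.
  have nA3 : ~ A3 w by move=> h; apply: nA; right; right; right; left.
  have nA4 : ~ A4 w by move=> h; apply: nA; right; right; right; right.
  have FD : F (Dstar n w) by exact: contrapT.
  have Dball : L2_ball P0 F D0 delta (Dstar n w).
    split=> //; rewrite leNgt; apply/negP => h; apply: nA3.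
    by rewrite /A3/= (lt_le_trans h)// lee_abs.
  have {nA0} h0 :
      `|emp_process P0 X n w (Dstar n w) - emp_process P0 X n w D0| <= e / 3.
    by rewrite leNgt; apply/negP => h; apply: nA0; exists (Dstar n w).
  have {nA1} h1 : `|emp_mean X n w (Dstar n w) / root_n_rate R n| <= e / 3.
    by rewrite leNgt; apply/negP => h; apply: nA1; rewrite /A1/= lte_fin.
  have {nA2} h2 : `|second_order_remainder (@Sigma2 R p) (Pstar n w) P0 (Dstar n w) /
      root_n_rate R n| <= e / 3.
    by rewrite leNgt; apply/negP => h; apply: nA2; rewrite /A2/= lte_fin.
  move: ew h0 h1 h2.
  rewrite /emp_process /second_order_remainder D0mean /root_n_rate invrK.
  set s := Num.sqrt _; set x := fine _; set y := fine _.
  set a := emp_mean X n w (Dstar n w); set b := emp_mean X n w D0; set m := mean _ _.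
  (* The mean [m] of [Dstar n w] under [P0] cancels between the remainder and the empirical process;
     the 0 is the mean of [D0]. *)
  have -> : (x - y - b) * s = (x - y + m) * s - a * s + (s * (a - m) - s * (b - 0)).
    by ring.
  have := ler_normD ((x - y + m) * s - a * s) (s * (a - m) - s * (b - 0)).
  have := ler_normB ((x - y + m) * s) (a * s); lra.
have -> : eta = eta / 5 + (eta / 5 + (eta / 5 + (eta / 5 + eta / 5))) by field.
rewrite !EFinD.
do 4! (apply: le_trans (outer_probabilityU _ _ _) _; apply: leeD => //).
Qed.
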